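(* For every $n\ge 1$, $|\mathcal{UD}_{2n+1}(4123)|=|\mathcal{UD}_{2n+1}(1234)|$.
   Context: A permutation $\pi=\pi_1\cdots\pi_m$ of $[m]=\{1,\ldots,m\}$ is up-down alternating if $\pi_1<\pi_2>\pi_3<\pi_4>\cdots$. It contains a pattern $\tau=\tau_1\cdots\tau_k$ if some subsequence $\pi_{i_1}\cdots\pi_{i_k}$ ($i_1<\cdots<i_k$) is order-isomorphic to $\tau$, and avoids $\tau$ otherwise. $\mathcal{UD}_m(\tau)$ denotes the set of $\tau$-avoiding up-down alternating permutations of $[m]$. *)

(* Defs.v *)
From mathcomp Require Import all_boot fingroup perm.

Set Implicit Arguments.
Unset Strict Implicit.
Unset Printing Implicit Defensive.

(* A permutation pi_1 ... pi_m of [m] is s : 'S_m, with positions and values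
   both shifted down by one: pi_(i+1) = s i + 1.  Hence the ascents required at
   odd 1-based positions are required at even i. *)
Definition up_down (m : nat) (s : 'S_m) : bool :=
  [forall i : 'I_m, forall j : 'I_m,
     (j == i.+1 :> nat) ==> (if odd i then s j < s i else s i < s j)].

(* A pattern is the word tau_1 ... tau_k of its values; only the relative order
   of these values matters, so they are kept 1-based. *)
Definition contains_pattern (m : nat) (s : 'S_m) (tau : seq nat) : bool :=
  [exists f : {ffun 'I_(size tau) -> 'I_m},
     [forall a : 'I_(size tau), forall b : 'I_(size tau),
        (a < b) ==> (f a < f b)] &&
     [forall a : 'I_(size tau), forall b : 'I_(size tau),
        (s (f a) < s (f b)) == (nth 0 tau a < nth 0 tau b)]].

Definition avoids (m : nat) (s : 'S_m) (tau : seq nat) : bool :=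
  ~~ contains_pattern s tau.

Definition UD (m : nat) (tau : seq nat) : {set 'S_m} :=
  [set s : 'S_m | up_down s && avoids s tau].

(* Main.v *)
(** Reversal preserves up-down words of odd length and turns 1234 into 4321, so
    4123 is compared with 4321.  Read a word from left to right; call a value
    "open" if it is missing and smaller than the current maximum.  In a
    4123-avoiding word the open values form intervals of sizes b_1, ..., b_k,
    each of which must be emptied from the top, and using the top of the j-th
    one merges all intervals above it.  In a 4321-avoiding word the open values
    consist of s values that must be used in increasing order, followed by f
    free ones.

    Both situations are counted by the same walks on partitions with at most
    two rows: opening a value adds a box, using one removes a box, and the
    alternation makes the remaining pairs of letters remove a whole column.
    The intervals correspond to h_(b_1) ... h_(b_k) and the pair (s, f) to
    e_1^f h_s in the ring of symmetric polynomials in two variables.  The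
    4123 words yield column removals before the box removal of a run, the 4321
    words after it, and these two operations commute. *)

Require Import Defs.
From Stdlib Require Import FunctionalExtensionality.
From mathcomp Require Import all_boot fingroup perm.
From mathcomp Require Import order ssralg ssrnum ssrint zify ring.

Set Implicit Arguments.
Unset Strict Implicit.
Unset Printing Implicit Defensive.

Import GRing.Theory.

(** * Functionals on two-row partitions *)

Section Walks.
Local Open Scope ring_scope.

(* [f a c] is the value of the functional [f] on the partition (c + a, c).  All
   operators below act on functionals, hence compose in the order opposite to
   that of the operations on partitions. *)
Definition func2 := nat -> nat -> int.
Implicit Types f g h : func2.

Definition comb f (t : int) g : func2 := fun a c => f a c + t * g a c.
Definition addbox f : func2 :=
  fun a c => f a.+1 c + (if a is a'.+1 then f a' c.+1 else 0).
Definition rembox f : func2 :=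
  fun a c => (if a is a'.+1 then f a' c else 0)
             + (if c is c'.+1 then f a.+1 c' else 0).
Definition addcol f : func2 := fun a c => f a c.+1.
Definition remcol f : func2 := fun a c => if c is c'.+1 then f a c' else 0.

(* Multiplication by h_n, the addition of a horizontal strip of size n, via
   h_(n+2) = e_1 h_(n+1) - e_2 h_n. *)
Fixpoint strip n f {struct n} : func2 :=
  if n is n'.+1 then
    if n' is n''.+1 then comb (strip n' (addbox f)) (-1) (strip n'' (addcol f))
    else addbox f
  else f.

Arguments strip : simpl never.

Lemma funext2 f g : (forall a c, f a c = g a c) -> f = g.
Proof.
by move=> fg; apply: functional_extensionality => a;
  apply: functional_extensionality.
Qed.

Lemma strip0 f : strip 0 f = f. Proof. by []. Qed.

Lemma strip1 f : strip 1 f = addbox f. Proof. by []. Qed.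

Lemma stripSS n f :
  strip n.+2 f = comb (strip n.+1 (addbox f)) (-1) (strip n (addcol f)).
Proof. by []. Qed.

Lemma addbox_comb f t g : addbox (comb f t g) = comb (addbox f) t (addbox g).
Proof. by apply: funext2 => -[|a] c; rewrite /addbox /comb /=; ring. Qed.

Lemma addcol_comb f t g : addcol (comb f t g) = comb (addcol f) t (addcol g).
Proof. by []. Qed.

(** The recursion of [strip] reaches back two steps. *)
Lemma nat_ind2 (Q : nat -> Prop) :
  Q 0%N -> Q 1%N -> (forall n, Q n -> Q n.+1 -> Q n.+2) -> forall n, Q n.
Proof.
move=> Q0 Q1 QS n; suff: Q n /\ Q n.+1 by case.
by elim: n => [|n [Qn Qn1]]; split=> //; apply: QS.
Qed.

Lemma strip_comb n f t g : strip n (comb f t g) = comb (strip n f) t (strip n g).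
Proof.
elim/nat_ind2: n f g => [|| n IH IH1] f g //; first exact: addbox_comb.
rewrite !stripSS addbox_comb addcol_comb IH1 IH.
by apply: funext2 => a c; rewrite /comb; ring.
Qed.

Lemma addbox_addcol f : addbox (addcol f) = addcol (addbox f).
Proof. by apply: funext2 => -[|a] c. Qed.

Lemma addbox_strip n f : addbox (strip n f) = strip n (addbox f).
Proof.
elim/nat_ind2: n f => [|| n IH IH1] f //.
by rewrite !stripSS addbox_comb IH IH1 addbox_addcol.
Qed.

Lemma addcol_strip n f : addcol (strip n f) = strip n (addcol f).
Proof.
elim/nat_ind2: n f => [|| n IH IH1] f //.
by rewrite !stripSS addcol_comb IH IH1 addbox_addcol.
Qed.

(* h_p h_q = h_(p+q) + e_2 h_(p-1) h_(q-1) for symmetric functions in two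
   variables. *)
Lemma strip_mul p q f : strip p.+1 (strip q.+1 f) =
  comb (strip (p + q).+2 f) 1 (addcol (strip p (strip q f))).
Proof.
elim/nat_ind2: p f => [|| p IH IH1] f.
- rewrite strip1 add0n stripSS addbox_strip.
  by apply: funext2 => a c; rewrite /comb !strip0 addcol_strip; ring.
- have S1 g : strip 1 (strip q.+1 g) = comb (strip q.+2 g) 1 (addcol (strip q g)).
    rewrite strip1 stripSS addbox_strip.
    by apply: funext2 => a c; rewrite /comb addcol_strip /=; ring.
  rewrite stripSS addbox_strip addcol_strip S1 addSn add0n [strip q.+3 _]stripSS.
  by apply: funext2 => a c; rewrite /comb strip0 strip1 addbox_strip; ring.
rewrite stripSS addbox_strip addcol_strip IH1 IH.
rewrite !addSn [strip (p + q).+4 _]stripSS [strip p.+2 _]stripSS.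
rewrite addcol_comb !(addcol_strip, addbox_strip).
by apply: funext2 => a c; rewrite /comb; ring.
Qed.

(** The only horizontal strip of size n on the empty partition is the row of length n. *)
Lemma strip00 n f : strip n f 0 0 = f n 0%N.
Proof.
elim/nat_ind2: n f => [|| n IH IH1] f //; first by rewrite strip1 /addbox addr0.
by rewrite stripSS /comb IH IH1 /addbox /addcol /=; ring.
Qed.

(* Multiplication by h_(n-1), with h_(-1) = 0. *)
Definition strip' n : func2 -> func2 :=
  if n is n'.+1 then strip n' else fun _ _ _ => 0.

(** * Products of complete homogeneous functions and box or column removal *)

Definition strips b f := foldr strip f b.

(* The cofactor of e_2 in h_(b_1) ... h_(b_k) - h_(b_1 + ... + b_k). *)
Fixpoint strips_rest b f : func2 :=
  if b is p :: b' then
    comb (strip' p (strip' (sumn b') f)) 1 (strip p (strips_rest b' f))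
  else fun _ _ => 0.

Lemma strip_0 n : strip n (fun _ _ => 0) = (fun _ _ => 0).
Proof.
have -> : (fun _ _ => 0) = comb (fun _ _ => 0) (-1) (fun _ _ => 0).
  by apply: funext2 => a c; rewrite /comb; ring.
by rewrite strip_comb; apply: funext2 => a c; rewrite /comb; ring.
Qed.

Lemma strip_sum (I : Type) (r : seq I) (Q : pred I) (F : I -> func2) n a c :
  strip n (fun a c => \sum_(i <- r | Q i) F i a c) a c =
  \sum_(i <- r | Q i) strip n (F i) a c.
Proof.
elim: r a c => [|i r IH] a c.
  rewrite big_nil.
  rewrite (_ : (fun _ _ => _) = fun _ _ => 0) ?strip_0 //.
  by apply: funext2 => *; rewrite big_nil.
rewrite big_cons; case: ifP => Qi; rewrite -IH.
  rewrite (_ : (fun _ _ => _) =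
    comb (F i) 1 (fun a c => \sum_(i <- r | Q i) F i a c)).
    by rewrite strip_comb /comb mul1r.
  by apply: funext2 => *; rewrite big_cons Qi /comb mul1r.
congr (strip _ _ _ _).
by apply: funext2 => *; rewrite big_cons Qi.
Qed.

(** Iterates h_p h_q = h_(p+q) + e_2 h_(p-1) h_(q-1), merging each factor with the sum of the later
    ones. On the empty partition the first term gives a single row, while every partition in the
    second has a full column. *)
Lemma strips_expand b f :
  strips b f = comb (strip (sumn b) f) 1 (addcol (strips_rest b f)).
Proof.
elim: b => [|p b IH] /=; first by apply: funext2 => a c; rewrite /comb/addcol; ring.
rewrite IH strip_comb addcol_comb -addcol_strip.
case: p (sumn b) => [|p] [|q] /=; rewrite ?addn0 ?add0n //;
  try by apply: funext2 => a c; rewrite /comb /addcol; ring.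
  by rewrite strip_0; apply: funext2 => a c; rewrite /comb strip0 /addcol; ring.
rewrite strip_mul addSn addnS.
by apply: funext2 => a c; rewrite /comb; ring.
Qed.

Lemma addcol_strips_rest b f : addcol (strips_rest b f) = strips_rest b (addcol f).
Proof.
elim: b => //= p b IH; rewrite addcol_comb addcol_strip IH.
by congr comb; case: p (sumn b) => [|p] [|q] //=; rewrite ?addcol_strip.
Qed.

(** This is the sum over j of h_(b_1) ... h_(b_(j-1)) h_(b_j - 1) h_(b_(j+1) + ... + b_k), with the
    recursion shaped like that of [strips_rest]. *)
Fixpoint strips_box b f : func2 :=
  if b is p :: b' then
    comb (strip' p (strip (sumn b') f)) 1 (strip p (strips_box b' f))
  else fun _ _ => 0.

(* h_(p-1) h_q + h_p h_(q-1) = h_(p+q-1) + e_1 h_(p-1) h_(q-1) *)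
Lemma strips_boxE b f :
  strips_box b f = comb (strip' (sumn b) f) 1 (strips_rest b (addbox f)).
Proof.
elim: b => [|p b IH] /=; first by apply: funext2 => a c; rewrite /comb; ring.
rewrite IH strip_comb.
case: p (sumn b) => [|p] [|q] /=; rewrite ?addn0 ?add0n ?addSn ?addnS ?strip_0 //;
  apply: funext2 => a c; rewrite /comb ?strip0; try ring.
case: p => [|p]; first by rewrite strip1 addbox_strip !strip0 add0n; ring.
rewrite strip_mul [strip p.+2 _]stripSS addSn /comb.
by rewrite !(addbox_strip, addcol_strip); ring.
Qed.

(** A column cannot be removed from a single row, and its removal undoes e_2; only the cofactor of
    e_2 survives in [strips_expand]. *)
Lemma strips_remcol b f : strips b (remcol f) 0 0 = strips_rest b f 0 0.
Proof.
rewrite strips_expand /comb strip00 addcol_strips_rest.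
have -> : addcol (remcol f) = f by [].
by rewrite /remcol add0r mul1r.
Qed.

(** With at most two rows, adding a column and then removing a box amounts to adding a box:
    [addcol (rembox f) = addbox f]. *)
Lemma strips_rembox b f : strips b (rembox f) 0 0 = strips_box b f 0 0.
Proof.
rewrite strips_expand strips_boxE /comb strip00 addcol_strips_rest.
have -> : addcol (rembox f) = addbox f.
  by apply: funext2 => -[|a] c; rewrite /addcol /rembox /addbox addrC.
by congr (_ + _); rewrite /rembox addr0; case: (sumn b) => //= n; rewrite strip00.
Qed.

(** Here j is the interval whose top is used; the intervals above it merge into one. *)
Lemma strips_boxS b f a c : strips_box b f a c =
  \sum_(j < size b | (0 < nth 0 b j)%N)
     strips (take j b ++ [:: (nth 0 b j).-1; sumn (drop j.+1 b)])%N f a c.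
Proof.
elim: b a c => [|p b IH] a c /=; first by rewrite big_ord0.
rewrite big_mkcond big_ord_recl /= drop0 -big_mkcond /= /comb mul1r.
congr (_ + _); first by case: p.
rewrite (_ : strips_box b f = (fun a c => \sum_(j < size b | (0 < nth 0 b j)%N)
     strips (take j b ++ [:: (nth 0 b j).-1; sumn (drop j.+1 b)])%N f a c)).
  by rewrite strip_sum.
exact: funext2.
Qed.

(** As before, but the top of the merged interval is used as well, so this interval must be
    nonempty. *)
Lemma strips_restS b f a c : strips_rest b f a c =
  \sum_(j < size b | (0 < nth 0 b j)%N && (0 < sumn (drop j.+1 b))%N)
     strips (take j b ++ [:: (nth 0 b j).-1; (sumn (drop j.+1 b)).-1])%N f a c.
Proof.
elim: b a c => [|p b IH] a c /=; first by rewrite big_ord0.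
rewrite big_mkcond big_ord_recl /= drop0 -big_mkcond /= /comb mul1r.
congr (_ + _); first by case: p (sumn b) => [|p] [|q] //=; rewrite strip_0.
rewrite (_ : strips_rest b f = (fun a c =>
  \sum_(j < size b | (0 < nth 0 b j)%N && (0 < sumn (drop j.+1 b))%N)
   strips (take j b ++ [:: (nth 0 b j).-1; (sumn (drop j.+1 b)).-1])%N f a c)).
  by rewrite strip_sum.
exact: funext2.
Qed.

(** * Commutation with box addition, and the recursions of the walks *)

Definition bottom f : func2 := fun a c => if c is 0 then f a 0%N else 0.

Lemma iter_bottom n f a c :
  iter n addbox (bottom f) a c = if c is 0 then f (a + n)%N 0%N else 0.
Proof.
elim: n a c => [|n IH] a c; first by rewrite addn0.
rewrite iterS /addbox IH; case: a c => [|a] [|c]; rewrite ?IH ?addr0 //.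
all: by rewrite addSnnS.
Qed.

Lemma iter_addbox_comb n f t g :
  iter n addbox (comb f t g) = comb (iter n addbox f) t (iter n addbox g).
Proof. by elim: n => //= n ->; rewrite addbox_comb. Qed.

Lemma iter_addbox_sum (I : Type) (r : seq I) (Q : pred I) (F : I -> func2) n a c :
  iter n addbox (fun a c => \sum_(i <- r | Q i) F i a c) a c =
  \sum_(i <- r | Q i) iter n addbox (F i) a c.
Proof.
elim: n a c => // n IH a c; rewrite iterS /addbox.
by case: a => [|a]; rewrite !IH ?addr0 -?big_split //=;
  apply: eq_bigr => i _; rewrite ?addr0.
Qed.

(** In Young's lattice the commutator would be the identity. If the second row is nonempty, the
    forbidden box in the third row cancels it; hence it survives on single rows only. *)
Lemma addbox_rembox f : addbox (rembox f) = comb (rembox (addbox f)) 1 (bottom f).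
Proof.
by apply: funext2 => -[|a] [|c]; rewrite /comb /rembox /addbox /bottom /=; ring.
Qed.

(** The correction comes from the box that starts the second row: it completes the only column that
    can then be removed. *)
Lemma addbox_remcol f : addbox (remcol f) =
  comb (remcol (addbox f)) 1
       (bottom (fun a c => if a is a'.+1 then f a' c else 0)).
Proof.
by apply: funext2 => -[|a] [|c]; rewrite /comb /remcol /addbox /bottom /=; ring.
Qed.

Lemma rembox_remcol f : rembox (remcol f) = remcol (rembox f).
Proof.
by apply: funext2 => -[|a] [|c]; rewrite /rembox /remcol /= ?addr0.
Qed.

(** Moving the removal past the additions leaves one commutator for each of them, and [bottom]
    forces the j earlier boxes into the first row. For 4321 words with s ordered and n free values,
    the first term uses the least ordered value and term j the free value number j, below which j
    free values become ordered. *)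
Lemma iter_addbox_rembox n f s : iter n addbox (rembox f) s 0%N =
  (if s is s'.+1 then iter n addbox f s' 0%N else 0) +
  \sum_(j < n) iter (n - j.+1) addbox f (s + j)%N 0%N.
Proof.
elim: n f => [|n IH] f; first by rewrite big_ord0.
rewrite iterSr addbox_rembox iter_addbox_comb /comb IH iter_bottom mul1r.
rewrite big_ord_recr /= subnn addrA; congr (_ + _ + _).
  by case: s {IH} => // s; rewrite -iterSr.
by apply: eq_bigr => j _; rewrite -iterSr subSn.
Qed.

(** Term j stands for an ascent to the free value number j followed by a descent to the least
    ordered value, which exists iff s + j is positive. *)
Lemma iter_addbox_remcol n f s : iter n addbox (remcol f) s 0%N =
  \sum_(j < n | (0 < s + j)%N) iter (n - j.+1) addbox f (s + j).-1 0%N.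
Proof.
elim: n f => [|n IH] f; first by rewrite big_ord0.
rewrite iterSr addbox_remcol iter_addbox_comb /comb IH iter_bottom mul1r.
rewrite [in RHS]big_mkcond big_ord_recr /= subnn -big_mkcond /=; congr (_ + _).
  by apply: eq_bigr => j _; rewrite -iterSr subSn.
by case: (s + n)%N.
Qed.

(* [u] is the number of values above the current maximum: a new maximum that
   opens [i] values uses up [i.+1] of them. *)
Fixpoint walks k u : func2 :=
  if k is k'.+1 then fun a c =>
    \sum_(i < u) iter i addbox (rembox (walks k' (u - i.+1)%N)) a c
    + remcol (walks k' u) a c
  else fun a c => ((a == 0%N) && (c == 0%N))%:R.

Lemma iter_walksS n k u s : iter n addbox (walks k.+1 u) s 0%N =
  \sum_(i < u) iter (n + i) addbox (rembox (walks k (u - i.+1))) s 0%N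
  + \sum_(j < n | (0 < s + j)%N)
       iter (n - j.+1) addbox (walks k u) (s + j).-1 0%N.
Proof.
rewrite -iter_addbox_remcol.
rewrite (_ : walks k.+1 u = comb (fun a c => \sum_(i < u)
  iter i addbox (rembox (walks k (u - i.+1))) a c) 1 (remcol (walks k u))).
  rewrite iter_addbox_comb /comb mul1r iter_addbox_sum; congr (_ + _).
  by apply: eq_bigr => i _; rewrite iterD.
by apply: funext2 => a c; rewrite /comb mul1r.
Qed.

Lemma strips_comb b f t g : strips b (comb f t g) = comb (strips b f) t (strips b g).
Proof. by elim: b => //= p b ->; rewrite strip_comb. Qed.

Lemma strips_sum (I : Type) (r : seq I) (Q : pred I) (F : I -> func2) b a c :
  strips b (fun a c => \sum_(i <- r | Q i) F i a c) a c =
  \sum_(i <- r | Q i) strips b (F i) a c.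
Proof.
elim: b a c => //= p b IH a c; rewrite -strip_sum.
by congr (strip _ _ _ _); apply: funext2.
Qed.

(** As e_1 = h_1, newly opened values count as intervals of size 1. *)
Lemma strips_nseq b i f : strips b (iter i addbox f) = strips (b ++ nseq i 1%N) f.
Proof.
rewrite /strips foldr_cat; congr (foldr _ _ _).
by elim: i => //= i ->; rewrite strip1.
Qed.

(** The recursion of the 4123 words: a descent to the top of interval j, then an ascent either to a
    new maximum or to the top of the merged interval. *)
Lemma strips_walksS b k u : strips b (rembox (walks k.+1 u)) 0 0 =
  \sum_(j < size b | (0 < nth 0 b j)%N)
   (\sum_(i < u) strips (take j b ++ (nth 0 b j).-1 :: sumn (drop j.+1 b)
                            :: nseq i 1)%N (rembox (walks k (u - i.+1))) 0 0
    + if (0 < sumn (drop j.+1 b))%N then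
        strips (take j b ++ [:: (nth 0 b j).-1; (sumn (drop j.+1 b)).-1])%N
               (rembox (walks k u)) 0 0
      else 0).
Proof.
rewrite big_split /= -big_mkcondr /= -strips_restS -strips_remcol.
(* [walks] takes the box away before the column; the letters of a 4123 word do the reverse. *)
rewrite -rembox_remcol strips_rembox.
rewrite exchange_big /=.
under eq_bigr => i _ do under eq_bigr => j _ do
  rewrite -cat1s -[sumn _ :: _]cat1s !catA -strips_nseq -catA.
under eq_bigr => i _ do rewrite -strips_boxS -strips_rembox.
rewrite -strips_rembox -strips_sum.
have -> : rembox (walks k.+1 u) = comb (fun a c => \sum_(i < u) rembox
   (iter i addbox (rembox (walks k (u - i.+1)))) a c) 1 (rembox (remcol (walks k u))).
  apply: funext2 => a c; rewrite /comb mul1r /rembox.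
  rewrite big_split /=; case: a c => [|a] [|c] /=; rewrite ?big1_eq; ring.
by rewrite strips_comb /comb mul1r.
Qed.
End Walks.

(** * Permutations as words built letter by letter *)

Definition word m (s : 'S_m) : seq nat := [seq val (s i) | i <- enum 'I_m].

Lemma size_word m (s : 'S_m) : size (word s) = m.
Proof. by rewrite size_map size_enum_ord. Qed.

Lemma nth_word m (s : 'S_m) (i : 'I_m) : nth 0 (word s) i = s i.
Proof. by rewrite (nth_map i) ?size_enum_ord // nth_ord_enum. Qed.

Lemma word_inj m : injective (@word m).
Proof.
move=> s t e; apply/permP => i; apply: val_inj => /=.
by rewrite -!nth_word e.
Qed.

Lemma word_uniq m (s : 'S_m) : uniq (word s).
Proof.
by rewrite map_inj_uniq ?enum_uniq // => i j /val_inj /perm_inj.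
Qed.

Lemma word_lt m (s : 'S_m) v : v \in word s -> v < m.
Proof. by move=> /mapP [i _ ->]; apply: ltn_ord. Qed.

Lemma mem_word m (s : 'S_m) v : (v \in word s) = (v < m).
Proof.
apply/idP/idP => [|lt_vm]; first exact: word_lt.
apply/mapP; exists ((s^-1)%g (Ordinal lt_vm)); rewrite ?mem_enum //.
by rewrite permKV.
Qed.

Lemma word_surj m p : size p = m -> uniq p -> all (gtn m) p ->
  exists s : 'S_m, word s = p.
Proof.
move=> sz_p uniq_p lt_p.
have lt_nth (i : 'I_m) : nth 0 p i < m by apply: (allP lt_p); rewrite mem_nth ?sz_p.
pose f i := Ordinal (lt_nth i).
have f_inj : injective f.
  by move=> i j [] /eqP; rewrite nth_uniq ?sz_p // => /eqP /val_inj.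
exists (perm f_inj); apply: (@eq_from_nth _ 0); rewrite size_word ?sz_p // => i lt_im.
by rewrite (nth_word _ (Ordinal lt_im)) permE.
Qed.

(** * Counting words by a condition on each letter *)

Definition steps_ok (ok : seq nat -> nat -> bool) (w : seq nat) :=
  all (fun k => ok (take k w) (nth 0 w k)) (iota 0 (size w)).

Implicit Types (ok : seq nat -> nat -> bool).

Lemma steps_okP ok w :
  reflect (forall k, k < size w -> ok (take k w) (nth 0 w k)) (steps_ok ok w).
Proof.
apply: (iffP allP) => H k; first by move=> lt_k; apply: H; rewrite mem_iota.
by rewrite mem_iota; apply: H.
Qed.

Lemma steps_ok_rcons ok p v : steps_ok ok (rcons p v) = steps_ok ok p && ok p v.
Proof.
rewrite /steps_ok size_rcons -addn1 iotaD all_cat /= add0n andbT.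
rewrite -cats1 take_size_cat // nth_cat ltnn subnn; congr (_ && _).
apply: eq_in_all => k; rewrite mem_iota => /= lt_k.
by rewrite takel_cat 1?ltnW // nth_cat lt_k.
Qed.

Lemma steps_ok_take ok k w : steps_ok ok w -> steps_ok ok (take k w).
Proof.
move/steps_okP=> H; apply/steps_okP => i; rewrite size_take_min leq_min.
by case/andP=> lt_ik lt_iw; rewrite take_takel 1?ltnW // nth_take //; apply: H.
Qed.

Section Count.
Variables (m : nat) (ok : seq nat -> nat -> bool).
Local Open Scope ring_scope.

(** The values are integers because they are compared with functionals, and [strip] involves
    signs. *)
Fixpoint cnt k (p : seq nat) : int :=
  if k is k'.+1 then
    \sum_(0 <= v < m | (v \notin p) && ok p v) cnt k' (rcons p v)
  else 1.

(** Induction on the number of missing letters: the permutations are sorted by the letter that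
    follows the prefix. *)
Lemma card_prefix k p : (size p + k = m)%N -> uniq p -> all (gtn m) p ->
  steps_ok ok p ->
  #|[set s : 'S_m | steps_ok ok (word s) & take (size p) (word s) == p]|%:R
  = cnt k p.
Proof.
elim: k p => [|k IH] p sz_p uniq_p lt_p ok_p.
  rewrite addn0 in sz_p; have [s word_s] := word_surj sz_p uniq_p lt_p.
  rewrite (_ : [set _ | _ & _] = [set s]) ?cards1 //.
  apply/setP => t; rewrite !inE take_oversize ?size_word ?sz_p // -word_s.
  by rewrite (inj_eq (@word_inj m)); case: eqP => [->|_]; rewrite ?word_s ?ok_p ?andbF.
have lt_sz : (size p < m)%N by lia.
pose i0 := Ordinal lt_sz.
rewrite -sum1_card natr_sum (partition_big (fun s : 'S_m => s i0) xpredT) //=.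
rewrite big_mkord [RHS]big_mkcond /=; apply: eq_bigr => v _.
have takeS (s : 'S_m) : (take (size p) (word s) == p) && (s i0 == v) =
    (take (size (rcons p v)) (word s) == rcons p v).
  rewrite size_rcons (take_nth 0) ?size_word // eqseq_rcons.
  by rewrite -[size p]/(val i0) nth_word.
transitivity
  (#|[set s : 'S_m | steps_ok ok (word s)
       & take (size (rcons p v)) (word s) == rcons p v]|%:R : int).
  by rewrite -sum1_card natr_sum; apply: eq_bigl => s; rewrite !inE -andbA takeS.
(* Every prefix of an accepted word is accepted and free of repetitions, so a rejected letter
   contributes nothing. *)
have none : (~~ ((v : nat) \notin p) || ~~ ok p v) ->
    [set s : 'S_m | steps_ok ok (word s)
       & take (size (rcons p v)) (word s) == rcons p v] = set0.
  move=> bad; apply/setP => s; rewrite !inE; apply/negP => /andP [ok_s /eqP take_s].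
  move: bad; have := take_uniq (size (rcons p v)) (word_uniq s).
  have := steps_ok_take (size (rcons p v)) ok_s.
  by rewrite take_s steps_ok_rcons rcons_uniq => /andP [_ ->] /andP [->].
case: ifP => [/andP [v_p ok_v] | /negbT].
  rewrite IH //.
  - by rewrite size_rcons addSnnS.
  - by rewrite rcons_uniq v_p.
  - by rewrite all_rcons lt_p andbT; exact: ltn_ord.
  - by rewrite steps_ok_rcons ok_p.
by rewrite negb_and => /none ->; rewrite cards0.
Qed.

Lemma card_steps_ok : #|[set s : 'S_m | steps_ok ok (word s)]|%:R = cnt m [::].
Proof.
rewrite -(@card_prefix m [::]) //; congr (_ %:R); apply: eq_card => s.
by rewrite !inE take0 eqxx andbT.
Qed.
End Count.

(** * Pattern avoidance as a condition on each letter *)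

Lemma containsP4 m (s : 'S_m) (t0 t1 t2 t3 : nat) :
  reflect (exists i j k l : 'I_m, [/\ i < j, j < k, k < l &
     forall a b : 'I_4,
       (s (tnth [tuple i; j; k; l] a) < s (tnth [tuple i; j; k; l] b)) =
       (tnth [tuple t0; t1; t2; t3] a < tnth [tuple t0; t1; t2; t3] b)])
  (contains_pattern s [:: t0; t1; t2; t3]).
Proof.
apply: (iffP existsP) => [[f /andP [inc ord]] | [i [j [k [l [ij jk kl ord]]]]]].
  have incf (a b : 'I_4) : a < b -> f a < f b.
    by move/forallP/(_ a)/forallP/(_ b)/implyP: inc.
  have ordf (a b : 'I_4) : (s (f a) < s (f b)) =
      (tnth [tuple t0; t1; t2; t3] a < tnth [tuple t0; t1; t2; t3] b).
    by move/forallP/(_ a)/forallP/(_ b)/eqP: ord => ->; rewrite !(tnth_nth 0).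
  exists (f (inord 0)), (f (inord 1)), (f (inord 2)), (f (inord 3)).
  split; try by apply: incf; rewrite !inordK.
  move=> a b; rewrite -ordf.
  have E (c : 'I_4) :
      tnth [tuple f (inord 0); f (inord 1); f (inord 2); f (inord 3)] c = f c.
    case: c => [[|[|[|[|c]]]] ltc] //; rewrite (tnth_nth (f (inord 0))) /=;
      by congr (f _); apply: val_inj; rewrite /= inordK.
  by rewrite !E.
exists [ffun a : 'I_4 => tnth [tuple i; j; k; l] a]; apply/andP; split.
  apply/forallP => a; apply/forallP => b; apply/implyP; rewrite !ffunE.
  rewrite !(tnth_nth i).
  by case: a b => [[|[|[|[|a]]]] lta] [[|[|[|[|b]]]] ltb] //= _; lia.
apply/forallP => a; apply/forallP => b; rewrite !ffunE ord.
by rewrite !(tnth_nth 0).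
Qed.

Lemma avoids4123P m (s : 'S_m) :
  reflect (forall i j k l : 'I_m, i < j -> j < k -> k < l ->
             s j < s k -> s k < s l -> s i <= s l)
          (avoids s [:: 4; 1; 2; 3]).
Proof.
apply: (iffP idP) => [/containsP4 av i j k l ij jk kl sjk skl | av].
  rewrite leqNgt; apply/negP => sli; apply: av; exists i, j, k, l; split=> // a b.
  rewrite !(tnth_nth i) !(tnth_nth 0).
  by case: a b => [[|[|[|[|a]]]] lta] [[|[|[|[|b]]]] ltb] //=; lia.
apply/containsP4 => -[i [j [k [l [ij jk kl ord]]]]].
have := av i j k l ij jk kl.
have := ord (inord 1) (inord 2); have := ord (inord 2) (inord 3).
have := ord (inord 3) (inord 0); rewrite !(tnth_nth i) !(tnth_nth 0) !inordK //=.
lia.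
Qed.

Lemma avoids1234P m (s : 'S_m) :
  reflect (forall i j k l : 'I_m, i < j -> j < k -> k < l ->
             s i < s j -> s j < s k -> s l <= s k)
          (avoids s [:: 1; 2; 3; 4]).
Proof.
apply: (iffP idP) => [/containsP4 av i j k l ij jk kl sjk skl | av].
  rewrite leqNgt; apply/negP => sli; apply: av; exists i, j, k, l; split=> // a b.
  rewrite !(tnth_nth i) !(tnth_nth 0).
  by case: a b => [[|[|[|[|a]]]] lta] [[|[|[|[|b]]]] ltb] //=; lia.
apply/containsP4 => -[i [j [k [l [ij jk kl ord]]]]].
have := av i j k l ij jk kl.
have := ord (inord 0) (inord 1); have := ord (inord 1) (inord 2).
have := ord (inord 2) (inord 3); rewrite !(tnth_nth i) !(tnth_nth 0) !inordK //=.
lia.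
Qed.

Definition alt_step (p : seq nat) v :=
  (p == [::]) || if odd (size p) then last 0 p < v else v < last 0 p.

(* As every missing value r will occur after v, the letter v is rejected as soon
   as some r would complete a forbidden pattern in which v is the third
   letter. *)
Definition step4123 m (p : seq nat) v :=
  alt_step p v && all (fun r => [|| r \in p, r <= v |
    pairwise (fun x y => (v <= y) || (x <= r)) p]) (iota 0 m).

Definition step4321 m (p : seq nat) v :=
  alt_step p v && all (fun r => [|| r \in p, v <= r |
    pairwise (fun x y => (y <= v) || (x <= y)) p]) (iota 0 m).

Lemma last_take_word m (s : 'S_m) k : k.+1 < m ->
  last 0 (take k.+1 (word s)) = nth 0 (word s) k.
Proof.
by move=> km; rewrite (take_nth 0) ?last_rcons // size_word; lia.
Qed.

Lemma up_downP m (s : 'S_m) :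
  reflect (forall k, k < m -> alt_step (take k (word s)) (nth 0 (word s) k))
          (up_down s).
Proof.
apply: (iffP forallP) => [alt [|k] km | alt i]; first by rewrite take0.
  have lt_km : k < m by lia.
  have /forallP/(_ (Ordinal km))/implyP/(_ (eqxx _)) := alt (Ordinal lt_km).
  rewrite -!nth_word /alt_step last_take_word // size_takel ?size_word ?(ltnW km) //=.
  by rewrite if_neg => ->; rewrite orbT.
apply/forallP => j; apply/implyP => /eqP eji.
have := alt i.+1; rewrite -eji => /(_ (ltn_ord j)).
rewrite nth_word eji /alt_step last_take_word -?eji ?ltn_ord // nth_word.
rewrite eji size_takel ?size_word -?eji ?(ltnW (ltn_ord j)) // eji /=.
have -> : (take i.+1 (word s) == [::]) = false.
  by apply/eqP => /(congr1 size); rewrite size_takel // size_word -eji ltnW.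
by rewrite if_neg.
Qed.

Lemma mem_take_word m (s : 'S_m) (l : 'I_m) k :
  ((s l : nat) \in take k (word s)) = (l < k).
Proof.
rewrite in_take; last by rewrite mem_word.
by rewrite -nth_word index_uniq ?size_word ?word_uniq.
Qed.

Lemma pairwise_take_wordP m (s : 'S_m) (R : rel nat) (k : 'I_m) :
  reflect (forall i j : 'I_m, i < j -> j < k -> R (s i) (s j))
          (pairwise R (take k (word s))).
Proof.
have sz : size (take k (word s)) = k by rewrite size_takel // size_word ltnW.
apply: (iffP (pairwiseP 0)); rewrite sz => H.
  move=> i j ij jk; have ik := ltn_trans ij jk.
  by have := H i j; rewrite !inE !nth_take // !nth_word; apply.
move=> i j; rewrite !inE => ik jk ij; rewrite !nth_take //.
have im := ltn_trans ik (ltn_ord k); have jm := ltn_trans jk (ltn_ord k).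
rewrite -[i]/(val (Ordinal im)) -[j]/(val (Ordinal jm)) !nth_word; exact: H.
Qed.

Lemma up_down_steps_okP m (s : 'S_m) (c : seq nat -> nat -> bool) :
  reflect (up_down s /\ forall k : 'I_m, c (take k (word s)) (s k))
          (steps_ok (fun p v => alt_step p v && c p v) (word s)).
Proof.
apply: (iffP (steps_okP _ _)) => [| [/up_downP ud H] k]; rewrite size_word => H'.
  split; first by apply/up_downP => k km; case/andP: (H' k km).
  by move=> k; case/andP: (H' k (ltn_ord k)) => _; rewrite nth_word.
by rewrite ud //=; have := H (Ordinal H'); rewrite -nth_word.
Qed.

Lemma all_iotaP m (s : 'S_m) (Q : pred nat) :
  reflect (forall l : 'I_m, Q (s l)) (all Q (iota 0 m)).
Proof.
apply: (iffP allP) => H => [l | r]; first by apply: H; rewrite mem_iota ltn_ord.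
rewrite mem_iota => /= rm; have := H ((s^-1)%g (Ordinal rm)).
by rewrite permKV.
Qed.

(** The values missing before position k, other than the letter at k, are those at later positions;
    hence [r] runs over all candidates for the last letter of a pattern. *)
Lemma mem_UD4123 m (s : 'S_m) :
  (s \in UD m [:: 4; 1; 2; 3]) = steps_ok (step4123 m) (word s).
Proof.
rewrite inE; apply/andP/up_down_steps_okP => -[ud b]; split=> //.
  move=> k; apply/(all_iotaP s) => l; rewrite mem_take_word.
  case: ltnP => //= kl; case: leqP => //= skl.
  have {}kl : k < l.
    rewrite ltn_neqAle kl andbT; apply: contraTneq skl => /val_inj ->.
    by rewrite ltnn.
  apply/pairwise_take_wordP => i j ij jk; move/avoids4123P: b => /(_ i j k l ij jk kl).
  lia.
apply/avoids4123P => i j k l ij jk kl sjk skl.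
have /(all_iotaP s)/(_ l) := b k; rewrite mem_take_word.
rewrite ltnNge (ltnW kl) /= leqNgt skl /= => /pairwise_take_wordP /(_ i j ij jk).
lia.
Qed.

(** Reversal flips every comparison and, the length being odd, also the parity of the left position
    of each adjacent pair. *)
Lemma up_down_rev n (s : 'S_(2 * n + 1)) :
  up_down s -> up_down (perm (@rev_ord_inj (2 * n + 1)) * s)%g.
Proof.
move=> /forallP ud; apply/forallP => i; apply/forallP => j; apply/implyP => /eqP eji.
have /forallP/(_ (rev_ord i))/implyP := ud (rev_ord j).
rewrite !permM !permE; have -> : odd (rev_ord j) = ~~ odd i.
  by rewrite /=; have := ltn_ord j; lia.
rewrite if_neg; apply; rewrite /=; apply/eqP; have := ltn_ord j; lia.
Qed.

Lemma mem_UD1234 n (s : 'S_(2 * n + 1)) :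
  (s \in UD (2 * n + 1) [:: 1; 2; 3; 4]) =
  steps_ok (step4321 (2 * n + 1)) (word (perm (@rev_ord_inj (2 * n + 1)) * s)%g).
Proof.
set rho := perm _; set t := (rho * s)%g.
have rhoE i : s (rev_ord i) = t i by rewrite permM permE.
have tE i : s i = t (rev_ord i) by rewrite -rhoE rev_ordK.
have udE : up_down s = up_down t.
  apply/idP/idP => [|/up_down_rev]; first exact: up_down_rev.
  rewrite -/rho; congr (up_down _); apply/permP => i.
  by rewrite !permM !permE rev_ordK.
rewrite inE udE; apply/andP/up_down_steps_okP => -[ud b]; split=> //.
  move=> k; apply/(all_iotaP t) => l; rewrite mem_take_word.
  case: ltnP => //= kl; case: leqP => //= skl.
  have {}kl : k < l.
    rewrite ltn_neqAle kl andbT; apply: contraTneq skl => /val_inj ->.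
    by rewrite ltnn.
  apply/pairwise_take_wordP => i j ij jk.
  move/avoids1234P: b => /(_ (rev_ord l) (rev_ord k) (rev_ord j) (rev_ord i)).
  have lm := ltn_ord l; rewrite !rhoE => av.
  have {}av : t l < t k -> t k < t j -> t i <= t j by apply: av => /=; lia.
  by case: leqP => //= skj; apply: av.
apply/avoids1234P => i j k l ij jk kl sij sjk.
have /(all_iotaP t)/(_ (rev_ord i)) := b (rev_ord j); rewrite mem_take_word.
have -> : (rev_ord i < rev_ord j) = false by rewrite /=; have := ltn_ord j; lia.
rewrite -!tE /= [s j <= _]leqNgt sij /= => /(pairwise_take_wordP t _ (rev_ord j)).
move=> /(_ (rev_ord l) (rev_ord k)); rewrite -!tE /=.
have lm := ltn_ord l => av.
have {}av : (s k <= s j) || (s l <= s k) by apply: av; lia.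
lia.
Qed.

Lemma card_UD4123 m : (#|UD m [:: 4; 1; 2; 3]|%:R = cnt m (step4123 m) m [::])%R.
Proof.
rewrite -card_steps_ok; congr (_ %:R)%R; apply: eq_card => s.
by rewrite [RHS]inE mem_UD4123.
Qed.

Lemma card_UD1234 n : (#|UD (2 * n + 1) [:: 1; 2; 3; 4]|%:R =
  cnt (2 * n + 1) (step4321 (2 * n + 1)) (2 * n + 1) [::])%R.
Proof.
rewrite -card_steps_ok; congr (_ %:R)%R.
rewrite -[RHS](card_preimset _ (@mulgI _ (perm (@rev_ord_inj (2 * n + 1))))).
by apply: eq_card => s; rewrite mem_UD1234 !inE.
Qed.

(** * Open values *)

Definition opens (p : seq nat) M := [seq v <- iota 0 M | v \notin p].

Lemma mem_opens p M v : (v \in opens p M) = (v \notin p) && (v < M).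
Proof. by rewrite mem_filter mem_iota. Qed.

Lemma opens_sorted p M : sorted ltn (opens p M).
Proof. by apply: sorted_filter (iota_ltn_sorted _ _); apply: ltn_trans. Qed.

Lemma opens_rcons p M v : opens (rcons p v) M = [seq w <- opens p M | w != v].
Proof.
rewrite /opens -filter_predI; apply: eq_filter => w /=.
by rewrite mem_rcons inE negb_or.
Qed.

Lemma opens_max p M i : M \in p -> all (geq M) p ->
  opens (rcons p (M.+1 + i)) (M.+1 + i) = opens p M ++ iota M.+1 i.
Proof.
move=> Mp /allP leM; rewrite /opens iotaD filter_cat add0n; congr (_ ++ _).
  rewrite -addn1 iotaD filter_cat /= mem_rcons inE add0n Mp orbT cats0.
  apply: eq_in_filter => w; rewrite mem_iota => /= wM.
  by rewrite mem_rcons inE; case: eqP => //; lia.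
apply/all_filterP/allP => w; rewrite mem_iota => wM.
rewrite mem_rcons inE negb_or; apply/andP; split; first by lia.
by apply/negP => /leM /=; lia.
Qed.

Record has_max (p : seq nat) M : Prop := HasMax
  { has_max_mem : M \in p; has_max_le : all (geq M) p }.

Lemma has_max_last p M : has_max p M -> last 0 p <= M.
Proof.
case=> Mp /allP leM; case/lastP: p Mp leM => // p v _ leM.
by rewrite last_rcons; apply: leM; rewrite mem_rcons mem_head.
Qed.

Lemma has_max_open p M v : has_max p M -> v \in opens p M -> has_max (rcons p v) M.
Proof.
case=> Mp leM; rewrite mem_opens => /andP [_ vM]; split.
  by rewrite mem_rcons inE Mp orbT.
by rewrite all_rcons leM andbT /=; lia.
Qed.

Lemma has_max_new p M i : has_max p M -> has_max (rcons p (M.+1 + i)) (M.+1 + i).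
Proof.
case=> Mp /allP leM; split; first by rewrite mem_rcons mem_head.
by rewrite all_rcons /= leqnn; apply/allP => x /leM /=; lia.
Qed.

Lemma missing_open p M v r : v <= M -> r < v -> r \notin p -> r \in opens p M.
Proof. by move=> vM rv rp; rewrite mem_opens rp; lia. Qed.

(** The next letter is an open value or a new maximum [M.+1 + i], which skips i values. *)
Lemma sum_unused m (ok : pred nat) (G : nat -> int) p M : has_max p M -> M < m ->
  (\sum_(0 <= v < m | (v \notin p) && ok v) G v =
   \sum_(v <- opens p M | ok v) G v +
   \sum_(i < m - M.+1 | ok (M.+1 + i)%N) G (M.+1 + i)%N)%R.
Proof.
case=> Mp /allP leM ltM.
rewrite (@big_cat_nat _ _ _ M) ?(ltnW ltM) //=; congr (_ + _)%R.
  by rewrite /opens big_filter_cond /index_iota subn0.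
rewrite big_ltn_cond // Mp /= -{1}[M.+1]add0n big_addn big_mkord.
apply: eq_big => [i | i _]; rewrite addnC //.
case: ok; rewrite ?andbF ?andbT //.
by apply/negP => /leM /=; lia.
Qed.

(** A dead end: a descent is due, but no smaller value is left. *)
Lemma cnt_last_min m c k q :
  (forall v, v \notin q -> last 0 q <= v) -> q != [::] -> ~~ odd (size q) ->
  cnt m (fun p v => alt_step p v && c p v) k.+1 q = 0%R.
Proof.
move=> ge_last q0 ev; rewrite /= big1 // => v /andP [vq /andP []].
rewrite /alt_step (negbTE q0) (negbTE ev) /= ltnNge ge_last //.
Qed.

(** * Words avoiding 4321 *)

Section Nesting.
Variable m : nat.

(** Says that [v] would not be the 2 of a pattern 4321 after [p]. *)
Definition nodesc (p : seq nat) v :=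
  pairwise (fun x y => (y <= v) || (x <= y)) p.

Definition free4321 p v :=
  all (fun r => [|| r \in p, v <= r | nodesc p v]) (iota 0 m).

Lemma step4321E p v : step4321 m p v = alt_step p v && free4321 p v.
Proof. by []. Qed.

(* The missing values below the maximum of p split into those lying below the
   bottom of some descent of p, which must appear in increasing order, and the
   other ones. *)
Record nest_state p M (S Fr : seq nat) : Prop := NestState
  { nest_max : has_max p M;
    nest_lt : M < m;
    nest_opens : opens p M = S ++ Fr;
    nest_S : {in S, forall r, ~~ nodesc p r};
    nest_Fr : {in Fr, forall r, nodesc p r} }.

(** All new descending pairs end in [v], and the one starting at [M] exists, so exactly the values
    below [v] become blocked. *)
Lemma nodesc_rcons p M v r : has_max p M -> v < M ->
  nodesc (rcons p v) r = nodesc p r && (v <= r).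
Proof.
case=> Mp _ vM; rewrite /nodesc pairwise_rcons andbC; congr (_ && _).
apply/allP/idP => [/(_ M Mp) | vr x _]; last by rewrite vr.
by rewrite [M <= v]leqNgt vM orbF.
Qed.

Lemma nodesc_max p M i r : has_max p M ->
  nodesc (rcons p (M.+1 + i)) r = nodesc p r.
Proof.
case=> _ /allP leM; rewrite /nodesc pairwise_rcons andbC.
rewrite [all _ _](_ : _ = true) ?andbT //.
by apply/allP => x /leM /= xM; apply/orP; right; lia.
Qed.

Lemma nodesc_ge p M v : has_max p M -> M <= v -> nodesc p v.
Proof.
case=> _ leM Mv; apply/(pairwiseP 0) => i j _ jp _.
by have /= := allP leM _ (mem_nth 0 jp); move=> /leq_trans ->.
Qed.

Lemma sorted_cat_lt (A B : seq nat) : sorted ltn (A ++ B) ->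
  {in A & B, forall x y, x < y}.
Proof.
move=> srt x y xA yB; have := srt; rewrite sorted_pairwise; last exact: ltn_trans.
by rewrite pairwise_cat => /and3P [/allrelP + _ _]; apply.
Qed.

Lemma nest_new p M S Fr i : nest_state p M S Fr -> M.+1 + i < m ->
  nest_state (rcons p (M.+1 + i)) (M.+1 + i) S (Fr ++ iota M.+1 i).
Proof.
case=> mx ltM opn hS hFr lti; split=> //; first exact: has_max_new.
- by case: mx => Mp leM; rewrite opens_max // opn catA.
- by move=> r rS; rewrite (nodesc_max _ _ mx); apply: hS.
move=> r; rewrite (nodesc_max _ _ mx) mem_cat => /orP [/hFr //|].
by rewrite mem_iota => rM; apply: nodesc_ge mx _; lia.
Qed.

Lemma nest_first p M v S Fr : nest_state p M (v :: S) Fr ->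
  nest_state (rcons p v) M S Fr.
Proof.
case=> mx ltM opn hS hFr.
have srt := opens_sorted p M; rewrite opn in srt.
have vO : v \in opens p M by rewrite opn mem_head.
have vM : v < M by move: vO; rewrite mem_opens => /andP [].
have vlt r : r \in S ++ Fr -> v < r.
  by move=> rSF; apply: (@sorted_cat_lt [:: v] (S ++ Fr)) => //; rewrite inE.
split=> //; first exact: has_max_open.
- rewrite opens_rcons opn /= eqxx /=; apply/all_filterP/allP => w /vlt.
  by rewrite neq_ltn => ->; rewrite orbT.
- by move=> r rS; rewrite (nodesc_rcons _ mx) // negb_and hS // inE rS orbT.
move=> r rF; rewrite (nodesc_rcons _ mx) // hFr //= ltnW // vlt //.
by rewrite mem_cat rF orbT.
Qed.

(** The pair [M], [v] lies above the j smaller free values, which thereby become ordered. *)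
Lemma nest_free p M S Fr j : nest_state p M S Fr -> j < size Fr ->
  nest_state (rcons p (nth 0 Fr j)) M (S ++ take j Fr) (drop j.+1 Fr).
Proof.
case=> mx ltM opn hS hFr jF; set v := nth 0 Fr j.
have srt := opens_sorted p M; rewrite opn in srt.
have eF : Fr = take j Fr ++ v :: drop j.+1 Fr by rewrite -drop_nth // cat_take_drop.
have vO : v \in opens p M by rewrite opn mem_cat mem_nth ?orbT.
have vM : v < M by move: vO; rewrite mem_opens => /andP [].
rewrite eF catA in srt.
have lt_v r : r \in S ++ take j Fr -> r < v.
  by move=> rS; apply: (sorted_cat_lt srt) => //; rewrite mem_head.
have gt_v r : r \in drop j.+1 Fr -> v < r.
  move=> rS; rewrite -cat_rcons in srt; apply: (sorted_cat_lt srt) => //.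
  by rewrite mem_rcons mem_head.
split=> //; first exact: has_max_open.
- rewrite opens_rcons opn [in LHS]eF catA filter_cat /= eqxx /=.
  congr (_ ++ _); apply/all_filterP/allP => w; first by move/lt_v; rewrite neq_ltn => ->.
  by move/gt_v; rewrite neq_ltn => ->; rewrite orbT.
- by move=> r /lt_v rv; rewrite (nodesc_rcons _ mx) // negb_and -ltnNge rv orbT.
move=> r rF; rewrite (nodesc_rcons _ mx) // hFr ?(mem_drop rF) //= ltnW //.
exact: gt_v.
Qed.

Lemma free4321_Fr p M S Fr v : nest_state p M S Fr -> v \in Fr -> free4321 p v.
Proof.
by case=> _ _ _ _ hFr vF; apply/allP => r _; rewrite hFr // !orbT.
Qed.

Lemma free4321_ge p M v : has_max p M -> M <= v -> free4321 p v.
Proof. by move=> mx Mv; apply/allP => r _; rewrite (nodesc_ge mx) // !orbT. Qed.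

Lemma missing_ge_first p M v O r : has_max p M -> opens p M = v :: O ->
  r \notin p -> v <= r.
Proof.
move=> mx opn rp; rewrite leqNgt; apply/negP => rv.
have vO : v \in opens p M by rewrite opn mem_head.
have vM : v < M by move: vO; rewrite mem_opens => /andP [].
have := missing_open (ltnW vM) rv rp; rewrite opn inE => /orP [|rO].
  by move/eqP=> er; rewrite er ltnn in rv.
have srt := opens_sorted p M; rewrite opn in srt.
have := @sorted_cat_lt [:: v] O srt v r; rewrite mem_head rO => /(_ isT isT).
by rewrite ltnNge (ltnW rv).
Qed.

Lemma free4321_first p M v O : has_max p M -> opens p M = v :: O -> free4321 p v.
Proof.
move=> mx opn; apply/allP => r _; case rp: (r \in p) => //=.
by rewrite (missing_ge_first mx opn) ?rp.
Qed.

(** The smaller value [v] is still missing and would complete a 4321 after [w]. *)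
Lemma free4321_S p M v S Fr w : nest_state p M (v :: S) Fr -> w \in S ->
  free4321 p w = false.
Proof.
case=> mx ltM opn hS _ wS.
have srt := opens_sorted p M; rewrite opn in srt.
have vO : v \in opens p M by rewrite opn mem_head.
move: vO; rewrite mem_opens => /andP [vp vM].
apply/negbTE/allPn; exists v; first by rewrite mem_iota /=; lia.
rewrite (negbTE vp) (negbTE (hS _ _)) ?inE ?wS ?orbT //= orbF -ltnNge.
by apply: (@sorted_cat_lt [:: v] (S ++ Fr)) => //; rewrite ?inE // mem_cat wS.
Qed.

Notation cnt4321 := (cnt m (step4321 m)).
Local Open Scope ring_scope.

(** An ascent is due and 2k letters remain. The value is that of e_1^f h_s, with the row of length s
    as starting partition. *)
Definition nest_claim k := forall p M S Fr, nest_state p M S Fr -> odd (size p) ->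
  {in Fr, forall r, (last 0%N p < r)%N} ->
  (size S + size Fr + (m - M.+1) = k.*2)%N ->
  cnt4321 k.*2 p = iter (size Fr) addbox (walks k (m - M.+1)) (size S) 0%N.

(** All open values lie below the last letter, so the descent may use the first ordered value or any
    free one, as in [iter_addbox_rembox]. *)
Lemma nest_after_max k q M S Fr : nest_claim k -> nest_state q M S Fr ->
  ~~ odd (size q) -> last 0%N q = M ->
  (size S + size Fr + (m - M.+1) = k.*2.+1)%N ->
  cnt4321 k.*2.+1 q =
  iter (size Fr) addbox (rembox (walks k (m - M.+1))) (size S) 0%N.
Proof.
move=> IH st ev lst sz; have [mx ltM opn hS hFr] := st.
have q0 : q != [::] by case: (q) mx => [[]|].
have srt := opens_sorted q M; rewrite opn in srt.
have alt v : (v < M)%N -> alt_step q v.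
  by move=> vM; rewrite /alt_step (negbTE ev) lst vM orbT.
have ltO v : v \in S ++ Fr -> (v < M)%N by rewrite -opn mem_opens => /andP [].
rewrite /= (sum_unused _ _ mx ltM) [X in _ + X]big1 ?addr0; last first.
  move=> i; rewrite step4321E /alt_step (negbTE q0) (negbTE ev) lst /=.
  by case/andP; lia.
rewrite opn big_cat /= iter_addbox_rembox; congr (_ + _).
  case: S st opn hS srt ltO sz => [|v S] st opn hS srt ltO sz; first by rewrite big_nil.
  rewrite big_cons step4321E alt ?ltO ?mem_head // (free4321_first mx opn) /=.
  rewrite big1_seq ?addr0.
    rewrite (IH _ _ _ _ (nest_first st)) // ?size_rcons /= ?ev //.
      move=> r rF; rewrite last_rcons.
      by apply: (@sorted_cat_lt [:: v] (S ++ Fr)) => //; rewrite ?inE // mem_cat rF orbT.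
    by move: sz => /=; lia.
  by move=> w /andP [+ wS]; rewrite step4321E (free4321_S st) // andbF.
rewrite (big_nth 0%N) big_mkord.
rewrite (eq_bigl xpredT) => [|j]; last first.
  have jF : nth 0%N Fr j \in Fr by rewrite mem_nth.
  by rewrite step4321E (free4321_Fr st) // alt // ltO // mem_cat jF orbT.
apply: eq_bigr => j _.
rewrite (IH _ _ _ _ (nest_free st (ltn_ord j))) ?size_rcons /= ?ev //.
- by rewrite size_cat size_takel ?(ltnW (ltn_ord j)) // size_drop.
- move=> r rF; rewrite last_rcons.
  move: srt; rewrite -[X in S ++ X](cat_take_drop j.+1) (take_nth 0%N) // catA.
  move/sorted_cat_lt; apply=> //.
  by rewrite mem_cat mem_rcons mem_head orbT.
rewrite size_cat size_takel ?(ltnW (ltn_ord j)) // size_drop.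
by have := ltn_ord j; lia.
Qed.

Lemma nest_count k : nest_claim k.
Proof.
elim: k => [|k IH] p M S Fr st od hlast sz.
  by case: S Fr sz {st hlast} => [|? ?] [|? ?] //=.
have [mx ltM opn hS hFr] := st.
have srt := opens_sorted p M; rewrite opn in srt.
have p0 : p != [::] by case: (p) mx => [[]|].
have alt v : (last 0 p < v)%N -> alt_step p v.
  by move=> vM; rewrite /alt_step od vM orbT.
rewrite doubleS iter_walksS [LHS]/= (sum_unused _ _ mx ltM) addrC; congr (_ + _).
  (* The ascent is to a new maximum; a descent follows. *)
  rewrite (eq_bigl xpredT) => [|i]; last first.
    rewrite step4321E alt ?(free4321_ge mx) //; first by lia.
    by have := has_max_last mx; lia.
  apply: eq_bigr => i _.
  have lti : (M.+1 + i < m)%N by have := ltn_ord i; lia.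
  rewrite -/(cnt4321 k.*2.+1 _).
  rewrite (nest_after_max IH (nest_new st lti)) ?size_rcons ?last_rcons /= ?od //.
    rewrite size_cat size_iota.
    by have -> : (m - (M.+1 + i).+1 = m - M.+1 - i.+1)%N by lia.
  by rewrite size_cat size_iota; lia.
(* An ascent to an ordered value can only use the first one, the least missing value; the descent
   due next is then impossible. *)
rewrite opn big_cat /= [X in X + _]big1_seq ?add0r; last first.
  move=> w /andP []; rewrite step4321E => /andP [_ fr].
  case: S st opn {hS srt sz} => // v S st opn; rewrite inE.
  case/orP => [/eqP ew | wS]; last first.
    by rewrite (free4321_S st) in fr.
  rewrite ew; apply: (@cnt_last_min m free4321 k.*2).
  - move=> r; rewrite mem_rcons inE negb_or last_rcons => /andP [_].
    exact: missing_ge_first mx opn.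
  - by case: (p).
  - by rewrite size_rcons /= od.
rewrite (big_nth 0%N) big_mkord.
rewrite [LHS](eq_bigl xpredT) => [|j]; last first.
  have jF : nth 0%N Fr j \in Fr by rewrite mem_nth.
  by rewrite step4321E (free4321_Fr st) // alt // hlast.
rewrite [RHS]big_mkcond; apply: eq_bigr => j _.
have stj := nest_free st (ltn_ord j); set v := nth 0%N Fr j in stj *.
have szS : size (S ++ take j Fr) = (size S + j)%N.
  by rewrite size_cat size_takel // ltnW.
have [mxj _ opnj _ _] := stj.
have ev : ~~ odd (size (rcons p v)) by rewrite size_rcons /= od.
have q0 : rcons p v != [::] by case: (p).
have srtj := opens_sorted (rcons p v) M; rewrite opnj in srtj.
rewrite -/(cnt4321 k.*2.+1 _).
(* Without ordered values, [v] is the least missing value and no descent can follow. *)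
case: ifP => sj; last first.
  apply: (@cnt_last_min m free4321 k.*2) => //.
  have S0 : S = [::] by apply: size0nil; lia.
  have j0 : j = 0%N :> nat by lia.
  move=> r; rewrite mem_rcons inE negb_or last_rcons => /andP [_].
  apply: (@missing_ge_first p M v (drop 1 Fr) r mx).
  by rewrite opn S0 /v j0 -drop_nth ?drop0 // -j0.
case eS: (S ++ take j Fr) szS stj opnj srtj => [|w S'] szS stj opnj srtj.
  by move: szS sj => /= <-.
have wO : w \in opens (rcons p v) M by rewrite opnj mem_head.
have gtv r : r \in drop j.+1 Fr -> (v < r)%N.
  move=> rF; move: srt; rewrite -[X in S ++ X](cat_take_drop j.+1) (take_nth 0%N) // catA.
  move/sorted_cat_lt; apply=> //.
  by rewrite mem_cat mem_rcons mem_head orbT.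
have wv : (w < v)%N.
  have wS : w \in S ++ take j Fr by rewrite eS mem_head.
  move: srt; rewrite -[Fr](cat_take_drop j) (drop_nth 0%N) // catA.
  by move/sorted_cat_lt; apply=> //; rewrite mem_head.
(* The descent from [v] must use an ordered value, and only the first of these, [w], is accepted. *)
rewrite [LHS]/= (sum_unused _ _ mxj ltM) [X in _ + X]big1 ?addr0; last first.
  move=> i; rewrite step4321E /alt_step (negbTE q0) (negbTE ev) last_rcons /=.
  have vF : v \in opens p M by rewrite opn mem_cat mem_nth ?orbT.
  by move: vF; rewrite mem_opens => /andP [_ vM] /andP []; lia.
rewrite opnj big_cons step4321E (free4321_first mxj opnj).
rewrite /alt_step (negbTE ev) last_rcons wv orbT /= big1_seq ?addr0; last first.
  move=> x /andP [+]; rewrite mem_cat step4321E => + /orP [xS | xF].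
    by rewrite (free4321_S stj) // andbF.
  by rewrite /alt_step (negbTE q0) (negbTE ev) last_rcons /= ltnNge (ltnW (gtv _ xF)).
move: szS => /= szS.
rewrite (IH _ _ _ _ (nest_first stj)) ?size_rcons /= ?od //.
- by rewrite size_drop -szS.
- by move=> r /gtv; rewrite last_rcons; apply: ltn_trans.
by rewrite size_drop; have := ltn_ord j; lia.
Qed.
End Nesting.

(** * Words avoiding 4123 *)

Section Crossing.
Variable m : nat.

(** For [v < r], says that they would not be the 2 and the 3 of a pattern 4123 after [p]. *)
Definition unlinked (p : seq nat) v r :=
  pairwise (fun x y => (v <= y) || (x <= r)) p.

Definition free4123 p v :=
  all (fun r => [|| r \in p, r <= v | unlinked p v r]) (iota 0 m).

Lemma step4123E p v : step4123 m p v = alt_step p v && free4123 p v.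
Proof. by []. Qed.

(* The missing values below the maximum of p form intervals [Bs]: two of them
   are in the same interval iff the larger one has to appear first. *)
Record cross_state p M (Bs : seq (seq nat)) : Prop := CrossState
  { cross_max : has_max p M;
    cross_lt : M < m;
    cross_opens : opens p M = flatten Bs;
    cross_in : all (pairwise (fun v r => ~~ unlinked p v r)) Bs;
    cross_out : pairwise (allrel (unlinked p)) Bs }.

Lemma unlinked_rcons p M v x r : has_max p M -> r < M ->
  unlinked (rcons p v) x r = unlinked p x r && (x <= v).
Proof.
case=> Mp _ rM; rewrite /unlinked pairwise_rcons andbC; congr (_ && _).
apply/allP/idP => [/(_ M Mp) | vr z _]; last by rewrite vr.
by rewrite [M <= r]leqNgt rM orbF.
Qed.

Lemma unlinked_le p v x r : x <= v -> unlinked (rcons p v) x r = unlinked p x r.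
Proof.
move=> xv; rewrite /unlinked pairwise_rcons andbC.
by rewrite [all _ _](_ : _ = true) ?andbT //; apply/allP => z _; rewrite xv.
Qed.

Lemma unlinked_ge p M x r : has_max p M -> M <= r -> unlinked p x r.
Proof.
case=> _ leM Mr; apply/(pairwiseP 0) => i j ip _ _.
by have /= := allP leM _ (mem_nth 0 ip); move=> /leq_trans ->; rewrite ?orbT.
Qed.

(** No letter before the new maximum exceeds a newly opened value, and no letter follows it yet, so
    the new values are linked to nothing. *)
Lemma cross_new p M Bs i : cross_state p M Bs -> M.+1 + i < m ->
  cross_state (rcons p (M.+1 + i)) (M.+1 + i) (Bs ++ [seq [:: r] | r <- iota M.+1 i]).
Proof.
case=> mx ltM opn hin hout lti.
have ltO x : x \in flatten Bs -> x < M by rewrite -opn mem_opens => /andP [].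
have eqU x r : x <= M -> unlinked (rcons p (M.+1 + i)) x r = unlinked p x r.
  by move=> xM; apply: unlinked_le; lia.
split=> //; first exact: has_max_new.
- by case: mx => Mp leM; rewrite opens_max // opn flatten_cat flatten_seq1.
- rewrite all_cat; apply/andP; split; last by rewrite all_map; apply/allP.
  apply/allP => B BBs; have := allP hin _ BBs.
  rewrite (@eq_in_pairwise _ (mem B) _
    (fun v r => ~~ unlinked (rcons p (M.+1 + i)) v r)) //.
  by move=> x r xB _; rewrite eqU // ltnW // ltO //; apply/flattenP; exists B.
rewrite pairwise_cat; apply/and3P; split.
- apply/allrelP => B C BBs /mapP [r]; rewrite mem_iota => rM ->; apply/allrelP => x y xB.
  rewrite inE => /eqP ->.
  have xM : x < M by apply: ltO; apply/flattenP; exists B.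
  by rewrite eqU 1?ltnW //; apply: unlinked_ge mx _; lia.
- apply/(pairwiseP [::]) => a b aBs bBs ab; apply/allrelP => x y xB yB.
  have xM : x < M by apply: ltO; apply/flattenP; exists (nth [::] Bs a); rewrite ?mem_nth.
  rewrite eqU 1?ltnW //; move/(pairwiseP [::]): hout => /(_ a b aBs bBs ab) /allrelP.
  exact.
rewrite pairwise_map; apply/(pairwiseP 0) => a b; rewrite !inE size_iota => ai bi ab /=.
rewrite allrel1l /= andbT !nth_iota // unlinked_le; last by lia.
by apply: unlinked_ge mx _; lia.
Qed.

Lemma cross_split p M L B v R : cross_state p M (L ++ rcons B v :: R) ->
  [/\ v < M, {in flatten L ++ B, forall x, x < v} & {in flatten R, forall x, v < x}].
Proof.
case=> mx ltM opn _ _; have srt := opens_sorted p M.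
rewrite opn flatten_cat /= cat_rcons catA in srt.
split.
- have : v \in opens p M by rewrite opn flatten_cat /= !mem_cat mem_rcons mem_head !orbT.
  by rewrite mem_opens => /andP [].
- by move=> x xL; apply: (sorted_cat_lt srt); rewrite ?mem_head.
rewrite -cat_rcons in srt => x xR; apply: (sorted_cat_lt srt) => //.
by rewrite mem_rcons mem_head.
Qed.

(** The pair [M], [v] links all open values above [v], which merges [R]; links whose smaller value
    lies below [v] are unchanged. *)
Lemma cross_choose p M L B v R : cross_state p M (L ++ rcons B v :: R) ->
  cross_state (rcons p v) M (L ++ [:: B; flatten R]).
Proof.
move=> st; have [vM ltv gtv] := cross_split st; case: st => mx ltM opn hin hout.
have vO : v \in opens p M.
  by rewrite opn flatten_cat /= !mem_cat mem_rcons mem_head !orbT.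
have ltO r : r \in flatten L ++ rcons B v ++ flatten R -> r < M.
  by move: (mem_opens p M r); rewrite opn flatten_cat /= => -> /andP [].
have eqU x r : x <= v -> unlinked (rcons p v) x r = unlinked p x r.
  exact: unlinked_le.
move: hin hout; rewrite all_cat /= pairwise_cat /= => /and3P [inL inB inR].
case/and3P => outLBR outL /andP [outBR outR].
have memL C x : C \in L -> x \in C -> x < v.
  by move=> CL xC; apply: ltv; rewrite mem_cat; apply/orP; left; apply/flattenP; exists C.
have memB x : x \in B -> x < v by move=> xB; apply: ltv; rewrite mem_cat xB orbT.
have eq_in C : {in C, forall x, x < v} ->
    pairwise (fun x r => ~~ unlinked (rcons p v) x r) C =
    pairwise (fun x r => ~~ unlinked p x r) C.
  move=> ltC; apply: (@eq_in_pairwise _ (mem C)); last by apply/allP => x.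
  by move=> x r xC _; rewrite eqU // ltnW // ltC.
have eq_out C C' : {in C, forall x, x < v} ->
    allrel (unlinked p) C C' -> allrel (unlinked (rcons p v)) C C'.
  by move=> ltC /allrelP H; apply/allrelP => x y xC yC; rewrite eqU ?H // ltnW // ltC.
split=> //; first exact: has_max_open.
- rewrite opens_rcons opn !flatten_cat /= cats0 cat_rcons !filter_cat /= eqxx /=.
  rewrite !catA; congr (_ ++ _).
    rewrite -filter_cat; apply/all_filterP/allP => w.
    by move/ltv; rewrite neq_ltn => ->.
  apply/all_filterP/allP => w.
  by move/gtv; rewrite neq_ltn => ->; rewrite orbT.
- rewrite all_cat /= andbT; apply/and3P; split.
  + apply/allP => C CL; rewrite eq_in; first exact: (allP inL).
    by move=> x; apply: memL.
  + by rewrite eq_in //; move: inB; rewrite pairwise_rcons => /andP [].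
  apply/(pairwiseP 0) => a b aR bR ab; rewrite (@unlinked_rcons _ M) //.
    by rewrite negb_and -ltnNge gtv ?orbT // mem_nth.
  by apply: ltO; rewrite !mem_cat mem_nth ?orbT.
rewrite pairwise_cat /= !andbT; apply/and3P; split.
- apply/allrelP => C C' CL; rewrite !inE => CB; apply: eq_out.
    by move=> x; apply: memL.
  apply/allrelP => x y xC; case/orP: CB => /eqP -> => [yB | /flattenP [D DR yD]].
    have /allrelP /(_ C (rcons B v) CL) := outLBR.
    by rewrite mem_head => /(_ isT) /allrelP; apply; rewrite // mem_rcons inE yB orbT.
  have /allrelP /(_ C D CL) := outLBR; rewrite inE DR orbT => /(_ isT) /allrelP.
  exact.
- apply/(pairwiseP [::]) => a b aL bL ab; apply: eq_out.
    by move=> x; apply: memL; rewrite mem_nth.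
  by move/(pairwiseP [::]): outL; apply.
apply: eq_out => //; apply/allrelP => x y xB /flattenP [D DR yD].
have /allP /(_ D DR) /allrelP := outBR; apply=> //.
by rewrite mem_rcons inE xB orbT.
Qed.

Lemma free4123_last p M L B v R : cross_state p M (L ++ rcons B v :: R) -> free4123 p v.
Proof.
move=> st; have [vM ltv gtv] := cross_split st; case: st => mx ltM opn hin hout.
apply/allP => r _; case rp: (r \in p) => //=; case: leqP => //= vr.
case: (ltnP r M) => rM; last exact: unlinked_ge mx _.
have : r \in opens p M by rewrite mem_opens rp.
rewrite opn flatten_cat /= !mem_cat mem_rcons inE => /or3P [rL|/orP [/eqP rv|rB]|rR].
- by have := ltv r; rewrite mem_cat rL => /(_ isT); lia.
- by rewrite rv ltnn in vr.
- by have := ltv r; rewrite mem_cat rB orbT => /(_ isT); lia.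
case/flattenP: rR => D DR rD.
move: hout; rewrite pairwise_cat /= => /and3P [_ _ /andP [/allP /(_ D DR) /allrelP + _]].
by apply=> //; rewrite mem_rcons mem_head.
Qed.

(** The top [v] of the interval is still missing and linked to [x]; it would complete a 4123. *)
Lemma free4123_nonlast p M L B v R x : cross_state p M (L ++ rcons B v :: R) ->
  x \in B -> free4123 p x = false.
Proof.
move=> st xB; have [vM ltv gtv] := cross_split st; case: st => mx ltM opn hin hout.
have : v \in opens p M.
  by rewrite opn flatten_cat /= !mem_cat mem_rcons mem_head !orbT.
rewrite mem_opens => /andP [vp _].
apply/negbTE/allPn; exists v; first by rewrite mem_iota /=; lia.
rewrite (negbTE vp) /= negb_or -ltnNge ltv /= ?mem_cat ?xB ?orbT //.
move: hin; rewrite all_cat /= pairwise_rcons => /and3P [_ /andP [/allP /(_ x xB)] //].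
Qed.

Lemma free4123_ge p M v : has_max p M -> M <= v -> free4123 p v.
Proof.
move=> mx Mv; apply/allP => r _; case: (leqP r v) => [|vr]; rewrite ?orbT //.
by rewrite (unlinked_ge _ mx) ?orbT //; lia.
Qed.

Notation cnt4123 := (cnt m (step4123 m)).
Local Open Scope ring_scope.

Lemma strips_sumn0 b f : sumn b = 0%N -> strips b f = f.
Proof. by elim: b => //= -[|p] b IH //= /IH ->. Qed.

Lemma cross_first k p M Bs : cross_state p M Bs -> ~~ odd (size p) ->
  {in flatten Bs, forall r, (r < last 0%N p)%N} ->
  cnt4123 k.+1 p = \sum_(j < size Bs | (0 < size (nth [::] Bs j))%N)
    cnt4123 k (rcons p (last 0%N (nth [::] Bs j))).
Proof.
move=> st ev hlast; have [mx ltM opn _ _] := st.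
have p0 : p != [::] by case: (p) mx => [[]|].
rewrite [LHS]/= (sum_unused _ _ mx ltM) [X in _ + X]big1 ?addr0; last first.
  move=> i; rewrite step4123E /alt_step (negbTE p0) (negbTE ev) /=.
  by have := has_max_last mx => lm /andP []; lia.
rewrite opn big_flatten (big_nth [::]) big_mkord [RHS]big_mkcond.
apply: eq_bigr => j _.
have eBs : Bs = take j Bs ++ nth [::] Bs j :: drop j.+1 Bs.
  by rewrite -drop_nth // cat_take_drop.
have sub x : x \in nth [::] Bs j -> x \in flatten Bs.
  by move=> xB; apply/flattenP; exists (nth [::] Bs j); rewrite ?mem_nth.
case/lastP: (nth [::] Bs j) eBs sub => [|B v] eBs sub; first by rewrite big_nil.
have hv : v \in flatten Bs by apply: sub; rewrite mem_rcons mem_head.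
rewrite eBs in st; rewrite size_rcons last_rcons /= -cats1 big_cat /=.
rewrite big1_seq ?add0r; last first.
  by move=> x /andP [+ xB]; rewrite step4123E (free4123_nonlast st) // andbF.
rewrite big_cons big_nil step4123E (free4123_last st) addr0.
by rewrite /alt_step (negbTE ev) hlast // orbT.
Qed.

Lemma cross_second k q M L B C v : cross_state q M (L ++ [:: B; C]) -> odd (size q) ->
  last 0%N q = v -> {in flatten L ++ B, forall x, (x < v)%N} ->
  {in C, forall x, (v < x)%N} -> (v < M)%N ->
  cnt4123 k.+1 q = \sum_(i < m - M.+1) cnt4123 k (rcons q (M.+1 + i))
    + if (0 < size C)%N then cnt4123 k (rcons q (last 0%N C)) else 0.
Proof.
move=> st od lst ltv gtv vM; have [mx ltM opn _ _] := st.
have q0 : q != [::] by case: (q) mx => [[]|].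
have altE x : alt_step q x = (v < x)%N by rewrite /alt_step (negbTE q0) od lst.
rewrite [LHS]/= (sum_unused _ _ mx ltM) addrC; congr (_ + _).
  apply: eq_bigl => i; rewrite step4123E altE (free4123_ge mx); lia.
rewrite opn flatten_cat /= cats0 catA big_cat /= big1_seq ?add0r; last first.
  by move=> x /andP [+ /ltv xv]; rewrite step4123E altE ltnNge (ltnW xv).
case/lastP: C st gtv {opn} => [|C w] st gtv; first by rewrite big_nil.
rewrite -cat_rcons in st; rewrite size_rcons last_rcons /= -cats1 big_cat /=.
rewrite big1_seq ?add0r; last first.
  by move=> x /andP [+ xB]; rewrite step4123E (free4123_nonlast st) // andbF.
rewrite big_cons big_nil step4123E (free4123_last st) addr0 altE gtv //.
by rewrite mem_rcons mem_head.
Qed.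

(** Each step consumes a descent and an ascent, after which all open values lie below the last
    letter again: this letter is a new maximum or the largest open value. *)
Lemma cross_count k p M Bs : cross_state p M Bs -> ~~ odd (size p) ->
  {in flatten Bs, forall r, (r < last 0%N p)%N} ->
  (size (flatten Bs) + (m - M.+1) = k.*2.+1)%N ->
  cnt4123 k.*2.+1 p = strips (shape Bs) (rembox (walks k (m - M.+1))) 0 0.
Proof.
elim: k p M Bs => [|k IH] p M Bs st ev hlast sz; rewrite (cross_first _ st) //.
  rewrite strips_rembox strips_boxS size_map.
  have szB := size_flatten Bs.
  apply: eq_big => [j | j jB]; first by rewrite (nth_map [::]).
  (* One letter is left; using it empties all intervals, so the walk ends at the empty partition. *)
  rewrite strips_sumn0 //.
  have : sumn (shape Bs) = (sumn (take j (shape Bs)) + (nth 0 (shape Bs) j +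
          sumn (drop j.+1 (shape Bs))))%N.
    by rewrite -{1}(cat_take_drop j (shape Bs)) (drop_nth 0%N) ?size_map // sumn_cat.
  rewrite sumn_cat /= (nth_map [::]) //; lia.
rewrite strips_walksS size_map; apply: eq_big => [j | j jB].
  by rewrite (nth_map [::]).
have [mx ltM opn _ _] := st.
have eBs : Bs = take j Bs ++ nth [::] Bs j :: drop j.+1 Bs.
  by rewrite -drop_nth // cat_take_drop.
rewrite /shape (nth_map [::]) // -map_take -map_drop -/(shape _) -/(shape _) -size_flatten.
set L := take j Bs in eBs *; set R := drop j.+1 Bs in eBs *.
case/lastP: (nth [::] Bs j) jB eBs => // B v _ eBs.
have stq : cross_state p M (L ++ rcons B v :: R) by rewrite -eBs.
have [vM ltv gtv] := cross_split stq; have {}stq := cross_choose stq.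
have szq : (size (flatten L) + size B + size (flatten R) + (m - M.+1) = k.*2.+2)%N.
  by move: sz; rewrite eBs flatten_cat /= !size_cat size_rcons; lia.
rewrite last_rcons size_rcons doubleS -[_.+1.-1]/(size B).
have odq : odd (size (rcons p v)) by rewrite size_rcons /= ev.
rewrite (@cross_second _ _ M L B (flatten R) v) ?last_rcons //; congr (_ + _).
  apply: eq_bigr => i _.
  have lti : (M.+1 + i < m)%N by have := ltn_ord i; lia.
  rewrite (IH _ _ _ (cross_new stq lti)) ?size_rcons /= ?negbK.
  - rewrite /shape !map_cat -catA /= -map_comp.
    have -> : (m - (M.+1 + i).+1 = m - M.+1 - i.+1)%N by lia.
    congr (strips (_ ++ _ :: _ :: _) _ _ _).
    by rewrite -[in RHS](size_iota M.+1 i); elim: (iota _ _) => //= ? ? ->.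
  - by [].
  - move=> r; rewrite last_rcons flatten_cat flatten_seq1 mem_cat => /orP [|].
      by case: stq => _ _ <- _ _; rewrite mem_opens => /andP [_]; lia.
    by rewrite mem_iota; lia.
  by rewrite !flatten_cat flatten_seq1 /= cats0 !size_cat size_iota; lia.
case/lastP eR: (flatten R) stq gtv szq => [|C w] stq gtv szq //.
rewrite size_rcons last_rcons -cat_rcons ltn0Sn in stq szq *.
have [wM ltw _] := cross_split stq.
(* Nothing lies above [w], so [cross_choose] appends an empty interval; it contributes h_0 = 1. *)
rewrite (IH _ _ _ (cross_choose stq)).
- by rewrite /shape -cats1 -catA !map_cat /= /strips !foldr_cat.
- by rewrite !size_rcons /= ev.
- move=> r; rewrite last_rcons flatten_cat /= cats0; apply: ltw.
by rewrite -cats1 !flatten_cat /= !cats0 !size_cat; lia.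
Qed.
End Crossing.

(** * The first two letters and the conclusion *)

Lemma has_max1 v : has_max [:: v] v.
Proof. by split; rewrite ?mem_head //= leqnn. Qed.

Lemma opens1 v : opens [:: v] v = iota 0 v.
Proof.
apply/all_filterP/allP => w; rewrite mem_iota inE /= => wv.
by rewrite neq_ltn wv.
Qed.

Lemma nest_state1 m v : v < m -> nest_state m [:: v] v [::] (iota 0 v).
Proof. by move=> vm; split=> //; [exact: has_max1 | rewrite opens1]. Qed.

Lemma cross_state1 m v : v < m ->
  cross_state m [:: v] v [seq [:: r] | r <- iota 0 v].
Proof.
move=> vm; split=> //; first exact: has_max1.
- by rewrite opens1 flatten_seq1.
- by rewrite all_map; apply/allP.
by apply/(pairwiseP [::]) => a b _ _ _; apply/allrelP.
Qed.

Section FirstSteps.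
Local Open Scope ring_scope.

Lemma cnt_first_steps m (c : seq nat -> nat -> bool) k :
  (forall v, c [::] v) -> (forall w v, c [:: w] v) ->
  cnt m (fun p v => alt_step p v && c p v) k.+2 [::] =
  \sum_(v < m) \sum_(i < m - v.+1)
    cnt m (fun p v => alt_step p v && c p v) k [:: val v; (v.+1 + i)%N].
Proof.
move=> c0 c1; set ok := fun p v => _.
rewrite [LHS]/= big_mkord; apply: eq_big => [v | v _]; first by rewrite /ok c0.
rewrite (sum_unused _ _ (has_max1 v) (ltn_ord v)) /= opens1.
rewrite big1_seq ?add0r.
  by apply: eq_bigl => i; rewrite /ok c1 /alt_step /=; lia.
by move=> w; rewrite mem_iota /ok /alt_step /=; lia.
Qed.

(** After the initial ascent all open values are free, respectively form intervals of size 1. Both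
    counts are then given by the same power of e_1 on the empty partition. *)
Lemma cnt4123_4321 m k : m = k.*2.+3 ->
  cnt m (step4123 m) m [::] = cnt m (step4321 m) m [::].
Proof.
move=> em.
have all_iota_true (T : pred nat) : (forall r, T r) -> all T (iota 0 m).
  by move=> H; apply/allP => r _.
(* Only the two letter counters are unfolded; [m] stays as the bound on values. *)
rewrite {3 6}em.
rewrite [LHS](@cnt_first_steps m (free4123 m)) ?[RHS](@cnt_first_steps m (free4321 m));
  try by move=> *; apply: all_iota_true => r; rewrite /= !orbT.
apply: eq_bigr => v _; apply: eq_bigr => i _.
have lti : (v.+1 + i < m)%N by have := ltn_ord i; lia.
have := nest_new (nest_state1 (ltn_ord v)) lti; rewrite /= => stn.
have := cross_new (cross_state1 (ltn_ord v)) lti; rewrite -map_cat => stc.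
rewrite -/(step4123 m) -/(step4321 m).
rewrite [RHS](nest_after_max (nest_count (k := k)) stn) //; last first.
  by rewrite size_cat !size_iota /=; lia.
rewrite [LHS](cross_count (k := k) stc) //; first last.
- by rewrite flatten_seq1 size_cat !size_iota; lia.
- by move=> r; rewrite flatten_seq1 mem_cat !mem_iota /=; lia.
rewrite -[iter _ _ _]/(strips [::] _) strips_nseq; congr (strips _ _ _ _).
by rewrite /shape -map_comp; elim: (_ ++ _) => //= ? ? ->.
Qed.
End FirstSteps.

Theorem theorem3p3 (n : nat) (hn : 1 <= n) :
  #|UD (2 * n + 1) [:: 4; 1; 2; 3]| = #|UD (2 * n + 1) [:: 1; 2; 3; 4]|.
Proof.
apply/eqP; rewrite -eqz_nat -!natz; apply/eqP.
rewrite card_UD4123 card_UD1234; apply: (@cnt4123_4321 _ n.-1).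
by rewrite -muln2; lia.
Qed.
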